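(* Let $(A,\mu)$ be a Maltsev algebra, with $\mu(x,y)$ written $xy$, and let $\alpha\colon A\to A$ be an algebra morphism. Let $[,,]$ be the triple product on $A$ given by $$[xyz]=2(xy)z-(zx)y-(yz)x.$$ Then $A_\alpha=(A,\ [,,]_\alpha=\alpha\circ[,,],\ \alpha)$ (with both twisting maps equal to $\alpha$) is a multiplicative Hom-Lie triple system.
   Context: We work over a fixed field $\mathbf{k}$ of characteristic $0$. A Maltsev algebra $(A,\mu)$ is a $\mathbf{k}$-module with an anti-symmetric bilinear multiplication $\mu$, $\mu(x,y)=xy$, satisfying $J'(x,y,xz)=J'(x,y,z)x$ for all $x,y,z\in A$, where $J'(x,y,z)=(xy)z+(zx)y+(yz)x$. An algebra morphism $\alpha\colon A\to A$ is a linear map with $\alpha(xy)=\alpha(x)\alpha(y)$. A Hom-Lie triple system $(L,[,,],(\alpha_1,\alpha_2))$ is a $\mathbf{k}$-module $L$ with a trilinear map $[,,]\colon L^{\otimes 3}\to L$ and linear maps $\alpha_1,\alpha_2\colon L\to L$ (twisting maps) such that $[uvw]=-[vuw]$, $[uvw]+[wuv]+[vwu]=0$, and $$[\alpha_1(x)\alpha_2(y)[uvw]]=[[xyu]\alpha_1(v)\alpha_2(w)]+[\alpha_1(u)[xyv]\alpha_2(w)]+[\alpha_1(u)\alpha_2(v)[xyw]]$$ for all $u,v,w,x,y\in L$. When $\alpha_1=\alpha_2=\alpha$ we write $(L,[,,],\alpha)$. It is multiplicative if $\alpha_1=\alpha_2=\alpha$ and $\alpha([xyz])=[\alpha(x)\alpha(y)\alpha(z)]$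 for all $x,y,z$. *)

(* Defs.v *)
From mathcomp Require Import all_boot all_order all_algebra.

Set Implicit Arguments.
Unset Strict Implicit.
Unset Printing Implicit Defensive.

Import GRing.Theory.
Local Open Scope ring_scope.

Definition jacobian (k : fieldType) (A : lmodType k) (mu : A -> A -> A)
    (x y z : A) : A :=
  mu (mu x y) z + mu (mu z x) y + mu (mu y z) x.

Record is_maltsev (k : fieldType) (A : lmodType k)
    (mu : {bilinear A -> A -> A}) : Prop := IsMaltsev {
  maltsev_antisym : forall x y : A, mu x y = - mu y x;
  maltsev_identity : forall x y z : A,
    jacobian mu x y (mu x z) = mu (jacobian mu x y z) x
}.

Definition trilinear (k : fieldType) (L : lmodType k)
    (br : L -> L -> L -> L) : Prop :=
  [/\ forall y z : L, linear (fun x => br x y z),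
      forall x z : L, linear (fun y => br x y z)
    & forall x y : L, linear (fun z => br x y z)].

Record is_hom_lie_triple_system (k : fieldType) (L : lmodType k)
    (br : L -> L -> L -> L) (a1 a2 : {linear L -> L}) : Prop := IsHomLTS {
  hom_lts_trilinear : trilinear br;
  hom_lts_antisym : forall u v w : L, br u v w = - br v u w;
  hom_lts_cyclic : forall u v w : L, br u v w + br w u v + br v w u = 0;
  hom_lts_identity : forall u v w x y : L,
    br (a1 x) (a2 y) (br u v w) =
      br (br x y u) (a1 v) (a2 w) + br (a1 u) (br x y v) (a2 w)
        + br (a1 u) (a2 v) (br x y w)
}.

Record is_multiplicative_hom_lie_triple_system (k : fieldType)
    (L : lmodType k) (br : L -> L -> L -> L) (a1 a2 : {linear L -> L}) :
    Prop := IsMultHomLTS {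
  mult_hom_lts : is_hom_lie_triple_system br a1 a2;
  mult_hom_lts_twist : a1 =1 a2;
  mult_hom_lts_morph : forall x y z : L,
    a1 (br x y z) = br (a1 x) (a1 y) (a1 z)
}.

Definition maltsev_triple (k : fieldType) (A : lmodType k)
    (mu : A -> A -> A) (x y z : A) : A :=
  mu (mu x y) z *+ 2 - mu (mu z x) y - mu (mu y z) x.

(* Main.v *)
Require Import Defs.
From mathcomp Require Import all_boot all_order all_algebra.

(** Write L_a for the multiplication z |-> a z. Up to the sign -1, the defect of
    L_a as a derivation of (u, v, w) |-> (u v) w is
    J'(a, u, v) w + J'(a, u v, w), and the linearized Maltsev identity says
    exactly that this defect is invariant under cyclic shifts of (u, v, w).
    Hence L_a is a derivation of the differences (u v) w - (w u) v, and so of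
    the triple product [u v w], which is a combination of such differences.
    Derivations are closed under sums and commutators, so
    [x y -] = 2 L_(x y) + L_x L_y - L_y L_x is a derivation as well, which is
    the fundamental identity of a Lie triple system. Twisting by alpha applies
    alpha twice to each side of that identity. *)

Set Implicit Arguments.
Unset Strict Implicit.
Unset Printing Implicit Defensive.

Import GRing.Theory.
Local Open Scope ring_scope.

Definition ternary_derivation (V : zmodType) (t : V -> V -> V -> V)
    (f : V -> V) : Prop :=
  forall u v w, f (t u v w) = t (f u) v w + t u (f v) w + t u v (f w).

Section TernaryDerivation.
Variables (k : fieldType) (L : lmodType k) (t : L -> L -> L -> L).
Hypothesis t_lin : trilinear t.

Lemma trilinearDl u u' v w : t (u + u') v w = t u v w + t u' v w.
Proof. by case: t_lin => h _ _; have := h v w 1 u u'; rewrite !scale1r. Qed.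

Lemma trilinearDm u v v' w : t u (v + v') w = t u v w + t u v' w.
Proof. by case: t_lin => _ h _; have := h u w 1 v v'; rewrite !scale1r. Qed.

Lemma trilinearDr u v w w' : t u v (w + w') = t u v w + t u v w'.
Proof. by case: t_lin => _ _ h; have := h u v 1 w w'; rewrite !scale1r. Qed.

Lemma ternary_derivationD f g :
  ternary_derivation t f -> ternary_derivation t g ->
  ternary_derivation t (fun z => f z + g z).
Proof.
move=> hf hg u v w; rewrite hf hg trilinearDl trilinearDm trilinearDr.
by rewrite (AC (3*3) ((1*4)*(2*5)*(3*6))).
Qed.

(** In [f (g (t u v w))] the terms where [f] and [g] act on different arguments are symmetric in [f]
    and [g], so they cancel in the commutator. *)
Lemma ternary_derivation_commutator f g :
  {morph f : u v / u + v} -> {morph g : u v / u + v} ->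
  ternary_derivation t f -> ternary_derivation t g ->
  ternary_derivation t (fun z => f (g z) - g (f z)).
Proof.
have fg_t f' g' : {morph f' : u v / u + v} ->
    ternary_derivation t f' -> ternary_derivation t g' ->
  forall u v w, f' (g' (t u v w)) =
    t (f' (g' u)) v w + t u (f' (g' v)) w + t u v (f' (g' w))
    + ((t (g' u) (f' v) w + t (f' u) (g' v) w)
       + (t (g' u) v (f' w) + t (f' u) v (g' w))
       + (t u (g' v) (f' w) + t u (f' v) (g' w))).
  move=> fD hf hg u v w; rewrite hg !fD !hf.
  by rewrite (AC (3*3*3) ((1*5*9)*((2*4)*(3*7)*(6*8)))).
(* With [g (f (t u v w))] moved to the right, only additivity of [t] in each slot is needed. *)
move=> fD gD hf hg u v w; apply/eqP; rewrite subr_eq; apply/eqP.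
rewrite (fg_t f g) // (fg_t g f) //.
rewrite [t (f u) (g v) w + _]addrC [t (f u) v (g w) + _]addrC.
rewrite [t u (f v) (g w) + _]addrC [RHS]addrA; congr (_ + _).
rewrite (AC (3*3) ((1*4)*(2*5)*(3*6))) /=.
by rewrite -trilinearDl -trilinearDm -trilinearDr !subrK.
Qed.

End TernaryDerivation.

Section Maltsev.
Variables (k : fieldType) (A : lmodType k) (mu : {bilinear A -> A -> A}).
Hypothesis hmu : is_maltsev mu.

Local Notation "x ∘ y" := (mu x y) (at level 40, left associativity).
Local Notation J := (jacobian mu).
Local Notation triple := (maltsev_triple mu).

Let mulC x y : x ∘ y = - (y ∘ x). Proof. exact: maltsev_antisym. Qed.

Lemma jacobian_cycle x y z : J x y z = J y z x.
Proof. by rewrite /jacobian (AC 3 (3*1*2)). Qed.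

Lemma jacobian_swap x y z : J y x z = - J x y z.
Proof.
rewrite /jacobian (mulC y x) (mulC z y) (mulC x z) !linearNl !opprD.
by rewrite addrAC.
Qed.

Lemma jacobianDl x x' y z : J (x + x') y z = J x y z + J x' y z.
Proof.
by rewrite /jacobian !(linearDl, linearDr) (AC (2*2*2) ((1*3*5)*(2*4*6))).
Qed.

Lemma jacobianDr x y z z' : J x y (z + z') = J x y z + J x y z'.
Proof. by rewrite -!(jacobian_cycle _ x y) jacobianDl. Qed.

Lemma jacobianNr x y z : J x y (- z) = - J x y z.
Proof. by rewrite /jacobian !(linearNl, linearNr) !opprD. Qed.

(** Polarization: replace [x] by [x + w] in the Maltsev identity and cancel the parts quadratic in
    [x] or in [w] alone. *)
Lemma maltsev_identity_linearized x y z w :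
  J x y (w ∘ z) + J w y (x ∘ z) = J x y z ∘ w + J w y z ∘ x.
Proof.
have := maltsev_identity hmu (x + w) y z.
rewrite linearDl jacobianDr !jacobianDl linearDr /=.
rewrite 2!(linearDl mu _ (J x y z)) /=.
rewrite !(maltsev_identity hmu).
rewrite [LHS](AC (2*2) ((1*4)*(3*2))) [RHS](AC (2*2) ((1*4)*(3*2))) /=.
by move/addrI.
Qed.

(** This is the linearized identity with [a] in its fixed slot [y]. The symmetries of [J] bring [a]
    to the front, and [w ∘ v = - (v ∘ w)] gives the signs. *)
Lemma jacobian_defect_cycle a u v w :
  J a u v ∘ w + J a (u ∘ v) w = J a v w ∘ u + J a (v ∘ w) u.
Proof.
have := maltsev_identity_linearized u a v w.
rewrite (mulC w v) jacobianNr (jacobian_swap a u v) linearNl.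
rewrite (jacobian_cycle u a) (jacobian_cycle w a (u ∘ v)) (jacobian_cycle w a v).
move/(canRL (addKr _)) ->; rewrite opprK.
by rewrite (AC (1*(1*2)) (1*3*4*2)) /= subrr add0r.
Qed.

(** By anticommutativity, the last two terms of [J a u v] are [u ∘ (a ∘ v)] and
    [- (a ∘ (u ∘ v))]. *)
Lemma mul_left_defect a u v :
  a ∘ (u ∘ v) = a ∘ u ∘ v + u ∘ (a ∘ v) - J a u v.
Proof.
rewrite /jacobian (mulC a (u ∘ v)) (mulC v a) linearNl -(mulC u) /=.
by rewrite [X in _ - X]addrC opprD addrA addrAC addrN add0r.
Qed.

Definition cyclic_difference u v w := u ∘ v ∘ w - w ∘ u ∘ v.

Lemma mul_left_derivation_cyclic_difference a :
  ternary_derivation cyclic_difference (mu a).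
Proof.
have defect u v w : a ∘ (u ∘ v ∘ w) = a ∘ u ∘ v ∘ w + u ∘ (a ∘ v) ∘ w
    + u ∘ v ∘ (a ∘ w) - (J a u v ∘ w + J a (u ∘ v) w).
  rewrite (mul_left_defect a (u ∘ v)) (mul_left_defect a u).
  rewrite linearBl linearDl /= [in RHS]opprD.
  by rewrite [LHS](AC 5 ((1*2*4)*(3*5))).
move=> u v w; rewrite /cyclic_difference linearBr /= !defect.
(* The shift [(w, u, v)] to [(u, v, w)] makes the two defects equal, and they cancel. *)
rewrite (jacobian_defect_cycle a w u v) opprB addrA subrK !opprD.
by rewrite (AC (3*3) ((1*5)*(2*6)*(3*4))).
Qed.

Lemma maltsev_triple_cyclic_difference u v w :
  triple u v w = cyclic_difference u v w - cyclic_difference v w u.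
Proof.
rewrite /maltsev_triple /cyclic_difference opprB mulr2n.
by rewrite (AC (2*1*1) ((1*3)*(2*4))).
Qed.

Lemma mul_left_derivation_triple a : ternary_derivation triple (mu a).
Proof.
move=> u v w; rewrite !maltsev_triple_cyclic_difference linearBr /=.
rewrite !mul_left_derivation_cyclic_difference !opprD.
by rewrite (AC (3*3) ((1*6)*(2*4)*(3*5))).
Qed.

Lemma maltsev_triple_trilinear : trilinear triple.
Proof.
(* Expanding any of the three slots gives this shape, so one regrouping serves all three goals. *)
have collect (c : k) (p p' q q' r r' : A) :
    (c *: p + p') *+ 2 - (c *: q + q') - (c *: r + r')
    = c *: (p *+ 2 - q - r) + (p' *+ 2 - q' - r').
  rewrite !scalerBr -scalerMnr mulrnDl !opprD.
  by rewrite (AC (2*2*2) ((1*3*5)*(2*4*6))).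
split=> [y z|x z|x y] c u v; rewrite /maltsev_triple;
  by rewrite !(linearPl, linearPr) collect.
Qed.

Lemma maltsev_triple_swap u v w : triple u v w = - triple v u w.
Proof.
rewrite /maltsev_triple (mulC v u) (mulC w v) (mulC u w) !linearNl /=.
by rewrite mulNrn !opprK !opprD !opprK addrAC.
Qed.

(** The cyclic sum of differences telescopes. *)
Lemma maltsev_triple_cyclic u v w :
  triple u v w + triple w u v + triple v w u = 0.
Proof.
rewrite !maltsev_triple_cyclic_difference.
by rewrite (AC (2*2*2) ((1*4)*(2*5)*(3*6))) /= !subrr addNr !addr0.
Qed.

Lemma triple_left_derivation x y : ternary_derivation triple (triple x y).
Proof.
(* The doubled term is spelled as a sum so that closure of derivations under addition covers it. *)
have tripleE z : triple x y z
    = (x ∘ y ∘ z + x ∘ y ∘ z) + (x ∘ (y ∘ z) - y ∘ (x ∘ z)).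
  rewrite /maltsev_triple (mulC (z ∘ x)) (mulC (y ∘ z)) (mulC z) linearNr /=.
  by rewrite !opprK mulr2n -!addrA [- _ + _]addrC.
have tL := maltsev_triple_trilinear.
have LD a : {morph mu a : u v / u + v} by move=> u v; rewrite linearDr.
have dL := mul_left_derivation_triple.
have dxy := ternary_derivationD tL (dL (x ∘ y)) (dL (x ∘ y)).
have dcomm := ternary_derivation_commutator tL (LD x) (LD y) (dL x) (dL y).
by move=> u v w; rewrite 4!tripleE; exact: (ternary_derivationD tL dxy dcomm).
Qed.

Lemma maltsev_triple_morph (f : {linear A -> A}) :
  {morph f : x y / x ∘ y} ->
  forall x y z, f (triple x y z) = triple (f x) (f y) (f z).
Proof.
by move=> fM x y z; rewrite /maltsev_triple !linearB linearMn /= !fM.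
Qed.

End Maltsev.

Theorem corollary3p17 (k : fieldType) (char0 : [pchar k] =i pred0)
    (A : lmodType k) (mu : {bilinear A -> A -> A}) (hmu : is_maltsev mu)
    (alpha : {linear A -> A})
    (halpha : forall x y : A, alpha (mu x y) = mu (alpha x) (alpha y)) :
  is_multiplicative_hom_lie_triple_system
    (fun x y z : A => alpha (maltsev_triple mu x y z)) alpha alpha.
Proof.
have tM := maltsev_triple_morph halpha.
have [lin1 lin2 lin3] := maltsev_triple_trilinear mu.
split=> // [|x y z]; last by rewrite tM.
split=> [|u v w|u v w|u v w x y].
- split=> [y z|x z|x y] c u v.
  + by rewrite lin1 linearP.
  + by rewrite lin2 linearP.
  + by rewrite lin3 linearP.
- by rewrite (maltsev_triple_swap hmu) linearN.
- by rewrite -!linearD (maltsev_triple_cyclic mu) linear0.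
- by rewrite -!tM (triple_left_derivation hmu) !linearD.
Qed.
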